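(* Let $\mathbb{K}$ be a field, let $A$, $B$ and $C$ be natural evolution algebras over $\mathbb{K}$, and suppose that $C$ is indecomposable with balance $\operatorname{b}(C)=1$. If $A\otimes C\cong B\otimes C$ relative to $C$ (isomorphism in the category of natural evolution algebras), then $A\cong B$.
   Context: An evolution algebra over $\mathbb{K}$ is a finite-dimensional (not necessarily associative) $\mathbb{K}$-algebra admitting a natural basis, i.e. a basis $\{e_1,\dots,e_n\}$ with $e_ie_j=0$ for $i\neq j$; it is non-degenerate if it has such a basis with all $e_i^2\ne0$ (this is then true of every natural basis). A natural evolution algebra is a non-degenerate evolution algebra $X$ with a fixed decomposition $X=\bigoplus_{i=1}^n A_i$ into one-dimensional subspaces (lines) with $A_iA_j=0$ for $i\ne j$; choosing a nonzero vector in each line gives a natural basis, so we write $X=\bigoplus_i\mathbb{K}b_i$. Morphisms of natural evolution algebras are $\mathbb{K}$-algebra homomorphisms sending each line isomorphically onto a line of the target. The tensor product $\bigoplus_i\mathbb{K}a_i\otimes\bigoplus_r\mathbb{K}c_r$ has lines $\mathbb{K}(a_i\otimes c_r)$, with $(a_i\otimes c_r)^2=a_i^2\otimes c_r^2$. $A\otimes C$ and $B\otimes C$, with $C=\bigoplus_r\mathbb{K}c_r$, are isomorphic relative to $C$ if there is an isomorphism $\varphi\colon A\otimes C\to B\otimes C$ such that for every natural basis vector $c_r$ of $C$ there is a linear map $\psi_r\colon A\to B$ with $\varphi(a\otimes c_r)=\psi_r(a)\otimes c_r$ for all $a\in A$. $C$ is indecomposable if it is nonzero and is not a direct sum of two nonzero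 ideals that are evolution algebras. The graph $\Gamma(C)$ is the directed graph whose vertices are the basis vectors $c_r$, with an edge $(c_r,c_s)$ whenever the coefficient of $c_s$ in $c_r^2$ is nonzero. A path in a directed graph is a sequence $(v_0,e_1,v_1,\dots,e_n,v_n)$, $n\ge 0$, of vertices and edges where each $e_i$ is traversed either forwards ($e_i=(v_{i-1},v_i)$) or backwards ($e_i=(v_i,v_{i-1})$); its balance is the number of forward steps minus the number of backward steps (a loop may be traversed in either direction, contributing $+1$ or $-1$ accordingly). A cycle is a path with $v_0=v_n$. The balance $\operatorname{b}(C)$ is the gcd of the absolute values of the balances of all cycles of $\Gamma(C)$. *)

(* Defs.v *)
From HB Require Import structures.
From mathcomp Require Import all_boot all_order all_algebra.

Set Implicit Arguments.
Unset Strict Implicit.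
Unset Printing Implicit Defensive.

Import GRing.Theory.
Local Open Scope ring_scope.

Section Evolution.
Variables (K : fieldType) (V : vectType K) (mul : {bilinear V -> V -> V}).
Implicit Types (U : {vspace V}) (s : seq V).

Definition natural_basis U s : Prop :=
  basis_of U s /\ {in s &, forall x y, x != y -> mul x y = 0}.

Definition evolution U : Prop := exists s, natural_basis U s.

Definition nondegenerate : Prop :=
  exists s, natural_basis fullv s /\ {in s, forall x, mul x x != 0}.

Definition is_ideal U : Prop :=
  forall x y, y \in U -> mul x y \in U /\ mul y x \in U.

Definition indecomposable_mul : Prop :=
  {:V}%VS <> 0%VS /\
  ~ exists U W : {vspace V},
      [/\ is_ideal U /\ is_ideal W, evolution U /\ evolution W,
          U <> 0%VS /\ W <> 0%VS
        & (U + W)%VS = fullv /\ (U :&: W)%VS = 0%VS].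

End Evolution.

Record natEvoAlg (K : fieldType) := NatEvoAlg {
  carrier :> vectType K;
  emul : {bilinear carrier -> carrier -> carrier};
  lines : finType;
  line : lines -> {vspace carrier};
  line_dim : forall i, \dim (line i) = 1%N;
  line_direct : directv (\sum_i line i);
  line_full : (\sum_i line i)%VS = fullv;
  line_orth : forall i j x y,
    i != j -> x \in line i -> y \in line j -> emul x y = 0;
  emul_nondegenerate : nondegenerate emul
}.

Arguments emul {K n}.
Arguments line {K n}.

Section NatEvoAlg.
Variables (K : fieldType).
Implicit Types X Y Z : natEvoAlg K.

Definition is_morphism X Y (f : 'Hom(X, Y)) : Prop :=
  (forall x y, f (emul x y) = emul (f x) (f y)) /\
  (forall i : lines X, exists j : lines Y,
     {in line i &, injective f} /\ (f @: line i)%VS = line j).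

Definition is_isomorphism X Y (f : 'Hom(X, Y)) : Prop :=
  is_morphism f /\
  exists g : 'Hom(Y, X), [/\ is_morphism g, cancel f g & cancel g f].

Definition isomorphic X Y : Prop := exists f : 'Hom(X, Y), is_isomorphism f.

Definition indecomposable X : Prop := indecomposable_mul (@emul K X).

(* The natural basis vector spanning the line i; the choice of the nonzero
   vector is immaterial below, since rescaling preserves every notion used. *)
Definition nvec X (i : lines X) : X := vpick (line i).

Definition nbasis X : #|lines X|.-tuple X :=
  [tuple nvec (enum_val i) | i < #|lines X|].

Definition ncoord X (i : lines X) (x : X) : K :=
  coord (nbasis X) (enum_rank i) x.

(* The vertex nvec r is encoded by its index r. *)
Definition Gamma X : rel (lines X) :=
  [rel r s | ncoord s (emul (nvec r) (nvec r)) != 0].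

Lemma nvec_neq0 X (i : lines X) : nvec i != 0.
Proof. by rewrite vpick0 -dimv_eq0 line_dim. Qed.

Lemma lineE X (i : lines X) : line i = <[nvec i]>%VS.
Proof.
apply/esym/eqP; rewrite eqEdim -memvE memv_pick /=.
by rewrite line_dim dim_vline nvec_neq0.
Qed.

Lemma card_lines X : #|lines X| = \dim {:X}.
Proof.
have := directvP (line_direct X); rewrite /= line_full => ->.
by rewrite (eq_bigr (fun=> 1%N)) ?sum1_card // => i _; rewrite line_dim.
Qed.

Lemma nbasisP X : basis_of fullv (nbasis X).
Proof.
rewrite basisEdim size_tuple -card_lines leqnn andbT.
rewrite -(line_full X); apply/subv_sumP => i _; rewrite lineE -memvE.
apply: memv_span; apply/tnthP; exists (enum_rank i).
by rewrite tnth_mktuple enum_rankK.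
Qed.

End NatEvoAlg.

Section Balance.
Variables (T : finType) (e : rel T).

(* A path starting at v is the list of its steps (d, w): the step goes to the
   vertex w, along the edge (v, w) if d = true (forwards), along the edge
   (w, v) if d = false (backwards). *)
Fixpoint is_path (v : T) (p : seq (bool * T)) : bool :=
  if p is (d, w) :: p' then (if d then e v w else e w v) && is_path w p'
  else true.

Definition path_end (v : T) (p : seq (bool * T)) : T := last v (map snd p).

Definition is_cycle (v : T) (p : seq (bool * T)) : bool :=
  is_path v p && (path_end v p == v).

Definition path_balance (p : seq (bool * T)) : int :=
  \sum_(st <- p) (if st.1 then 1 else -1).

(* b is the gcd of the (possibly infinite) family of absolute values of the
   balances of the cycles. *)
Definition graph_balance (b : nat) : Prop :=
  (forall v p, is_cycle v p -> (b %| `|path_balance p|)%N) /\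
  (forall d : nat, (forall v p, is_cycle v p -> (d %| `|path_balance p|)%N) ->
     (d %| b)%N).

End Balance.

Definition has_balance (K : fieldType) (C : natEvoAlg K) (b : nat) : Prop :=
  graph_balance (@Gamma K C) b.

(* The tensor product U (x) W, realized as the space of dim U x dim W matrices
   by means of coordinates in the bases vbasis fullv of U and W. *)
Section TensorSpace.
Variable K : fieldType.
Implicit Types U V W : vectType K.

Definition tspace U W : vectType K := 'M[K]_(\dim {:U}, \dim {:W}).

Definition tens U W (u : U) (w : W) : tspace U W :=
  \matrix_(i, j) (coord (vbasis fullv) i u * coord (vbasis fullv) j w).

Lemma tens_is_bilinear U W : bilinear_for *:%R *:%R (@tens U W).
Proof.
split=> z a x y; apply/matrixP => i j; rewrite !mxE linearP /=.
  by rewrite mulrDl mulrA.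
by rewrite mulrDr mulrCA.
Qed.

HB.instance Definition _ U W :=
  bilinear_isBilinear.Build K U W (tspace U W) *:%R *:%R (@tens U W)
    (tens_is_bilinear U W).

Definition ebase V (i : 'I_(\dim {:V})) : V := tnth (vbasis fullv) i.

Lemma ebase_sum V (v : V) : v = \sum_i coord (vbasis fullv) i v *: ebase i.
Proof.
rewrite {1}(coord_vbasis (memvf v)); apply: eq_bigr => i _.
by rewrite /ebase (tnth_nth 0).
Qed.

Lemma coord_ebase V i j : coord (vbasis fullv) i (@ebase V j) = (i == j)%:R.
Proof.
by rewrite /ebase (tnth_nth 0) coord_free ?(basis_free (vbasisP _)) // eq_sym.
Qed.

Lemma tens_ebase U W i j : tens (@ebase U i) (@ebase W j) = delta_mx i j.
Proof.
by apply/matrixP => k l; rewrite !mxE !coord_ebase -natrM mulnb.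
Qed.

Lemma tens_sum U W (x : tspace U W) :
  x = \sum_i \sum_j x i j *: tens (ebase i) (ebase j).
Proof.
rewrite {1}[x]matrix_sum_delta; apply: eq_bigr => i _.
by apply: eq_bigr => j _; rewrite tens_ebase.
Qed.

Lemma tens_neq0 U W (u : U) (w : W) : u != 0 -> w != 0 -> tens u w != 0.
Proof.
have nz V (v : V) : v != 0 -> exists i, coord (vbasis fullv) i v != 0.
  move=> v0; apply/existsP; apply: contraR v0 => /existsPn h.
  rewrite [v]ebase_sum big1 // => i _.
  by have := h i; rewrite negbK => /eqP ->; rewrite scale0r.
move=> /nz[i ui] /nz[j wj]; apply/eqP => /matrixP/(_ i j)/eqP.
by rewrite !mxE mulf_eq0 (negbTE ui) (negbTE wj).
Qed.

Lemma tens_universal U W V (f : {bilinear U -> W -> V}) :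
  exists! g : 'Hom(tspace U W, V), forall u w, g (tens u w) = f u w.
Proof.
pose h (x : tspace U W) := \sum_i \sum_j x i j *: f (ebase i) (ebase j).
have hl : linear h.
  move=> a x y; rewrite /h scaler_sumr -big_split; apply: eq_bigr => i _ /=.
  rewrite scaler_sumr -big_split; apply: eq_bigr => j _ /=.
  by rewrite !mxE scalerDl scalerA.
pose hM := GRing.isLinear.Build K (tspace U W) V _ h hl.
pose hL : {linear tspace U W -> V} := HB.pack h hM.
have hE : linfun hL =1 h by move=> x; rewrite lfunE.
exists (linfun hL); split=> [u w|g gE].
  rewrite hE /h [in RHS](ebase_sum u) linear_sumlz.
  apply: eq_bigr => i _; rewrite [in RHS](ebase_sum w) linear_sumr.
  apply: eq_bigr => j _.
  by rewrite !mxE linearZl_LR linearZr_LR scalerA.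
apply/lfunP => x; rewrite hE [in RHS](tens_sum x) linear_sum.
apply: eq_bigr => i _; rewrite linear_sum; apply: eq_bigr => j _.
by rewrite linearZ; congr (_ *: _); rewrite -gE.
Qed.

Lemma tens_span U W (s : seq U) (t : seq W) (T : {vspace tspace U W}) :
  <<s>>%VS = fullv -> <<t>>%VS = fullv ->
  {in s & t, forall u w, tens u w \in T} -> T = fullv.
Proof.
move=> sf tf h; apply/eqP; rewrite eqEsubv subvf; apply/subvP => x _.
have h1 u w : u \in s -> tens u w \in T.
  move=> us; have := memvf w; rewrite -tf => /(coord_span (X := in_tuple t)) ->.
  rewrite linear_sumr; apply: memv_suml => i _; rewrite linearZr_LR memvZ //.
  by apply: h => //; apply: mem_nth.
have h2 u w : tens u w \in T.
  have := memvf u; rewrite -sf => /(coord_span (X := in_tuple s)) ->.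
  rewrite linear_sumlz; apply: memv_suml => i _; rewrite linearZl_LR memvZ //.
  by apply: h1; apply: mem_nth.
rewrite (tens_sum x); apply: memv_suml => i _; apply: memv_suml => j _.
exact: memvZ.
Qed.

Lemma tspace_dim U W : \dim {:tspace U W} = (\dim {:U} * \dim {:W})%N.
Proof. by rewrite dimvf. Qed.

Lemma tens_basis U W (s : seq U) (t : seq W) :
  basis_of fullv s -> basis_of fullv t ->
  basis_of fullv [seq tens u w | u <- s, w <- t].
Proof.
move=> sb tb; rewrite basisEdim size_allpairs.
rewrite -(size_basis (X := in_tuple s) sb) -(size_basis (X := in_tuple t) tb).
rewrite tspace_dim leqnn andbT.
rewrite (tens_span (span_basis sb) (span_basis tb) (T := <<_>>)) ?subvv //.
by move=> u w us wt; apply/memv_span/allpairs_f.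
Qed.

End TensorSpace.

Section TensorAlgebra.
Variables (K : fieldType) (A C : natEvoAlg K).

(* The bilinear extension of (a (x) c)(a' (x) c') = aa' (x) cc'; see tmulE. *)
Definition tmul (x y : tspace A C) : tspace A C :=
  \sum_(p : 'I_(\dim {:A}) * 'I_(\dim {:C}))
    \sum_(q : 'I_(\dim {:A}) * 'I_(\dim {:C}))
      (x p.1 p.2 * y q.1 q.2) *:
        tens (emul (ebase p.1) (ebase q.1)) (emul (ebase p.2) (ebase q.2)).

Lemma tmul_is_bilinear : bilinear_for *:%R *:%R tmul.
Proof.
split=> z a x y; rewrite /= /tmul scaler_sumr -big_split;
  apply: eq_bigr => p _ /=;
  rewrite scaler_sumr -big_split; apply: eq_bigr => q _ /=;
  rewrite scalerA -scalerDl !mxE; congr (_ *: _).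
  by rewrite mulrDl mulrA.
by rewrite mulrDr mulrCA.
Qed.

HB.instance Definition _ :=
  bilinear_isBilinear.Build K (tspace A C) (tspace A C) (tspace A C)
    *:%R *:%R tmul tmul_is_bilinear.

Lemma tmulE (a a' : A) (c c' : C) :
  tmul (tens a c) (tens a' c') = tens (emul a a') (emul c c').
Proof.
have El (X : natEvoAlg K) (x y : X) :
    emul x y = \sum_i coord (vbasis fullv) i x *: emul (ebase i) y.
  rewrite {1}(ebase_sum x) linear_sumlz.
  by apply: eq_bigr => i _; rewrite linearZl_LR.
have Er (X : natEvoAlg K) (x y : X) :
    emul x y = \sum_i coord (vbasis fullv) i y *: emul x (ebase i).
  rewrite {1}(ebase_sum y) linear_sumr.
  by apply: eq_bigr => i _; rewrite linearZr_LR.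
rewrite [in RHS](El A a a') linear_sumlz /tmul.
rewrite -(pair_bigA _ (fun i k => \sum_q (tens a c i k * tens a' c' q.1 q.2) *:
  tens (emul (ebase i) (ebase q.1)) (emul (ebase k) (ebase q.2)))) /=.
apply: eq_bigr => i _; rewrite [in RHS](El C c c') linear_sumr.
apply: eq_bigr => k _.
rewrite linearZl_LR linearZr_LR [in RHS](Er A _ a') linear_sumlz /=.
rewrite !scaler_sumr.
rewrite -(pair_bigA _ (fun j l => (tens a c i k * tens a' c' j l) *:
  tens (emul (ebase i) (ebase j)) (emul (ebase k) (ebase l)))) /=.
apply: eq_bigr => j _; rewrite [in RHS](Er C _ c') linear_sumr /= !scaler_sumr.
apply: eq_bigr => l _; rewrite linearZl_LR linearZr_LR /= !scalerA !mxE.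
by congr (_ *: _); rewrite -!mulrA.
Qed.

Definition tline (p : lines A * lines C) : {vspace tspace A C} :=
  <[tens (nvec p.1) (nvec p.2)]>.

Lemma tline_dim p : \dim (tline p) = 1%N.
Proof. by rewrite dim_vline tens_neq0 // nvec_neq0. Qed.

Lemma tline_full : (\sum_p tline p)%VS = fullv.
Proof.
apply: (tens_span (span_basis (nbasisP A)) (span_basis (nbasisP C))).
move=> _ _ /tnthP[i ->] /tnthP[r ->]; rewrite !tnth_mktuple memvE.
by rewrite (sumv_sup (enum_val i, enum_val r)).
Qed.

Lemma tline_direct : directv (\sum_p tline p).
Proof.
rewrite directvE /= tline_full tspace_dim -!card_lines -card_prod -sum1_card.
by apply/eqP/eq_bigr => p _; rewrite tline_dim.
Qed.

Lemma emul_nvec0 (X : natEvoAlg K) (i j : lines X) :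
  i != j -> emul (nvec i) (nvec j) = 0.
Proof. by move=> ij; apply: (line_orth ij); apply: memv_pick. Qed.

Lemma tline_orth p q x y :
  p != q -> x \in tline p -> y \in tline q -> tmul x y = 0.
Proof.
move=> pq /vlineP[k ->] /vlineP[l ->].
rewrite linearZl_LR linearZr_LR /= tmulE.
case: (eqVneq p.1 q.1) => [e1|n1]; last first.
  by rewrite (emul_nvec0 n1) linear0l !scaler0.
suff n2 : p.2 != q.2 by rewrite (emul_nvec0 n2) linear0r !scaler0.
by apply: contra_neq pq => e2; apply/pair_eqP; rewrite /= e1 e2 /pair_eq !eqxx.
Qed.

Lemma tmul_nondegenerate : nondegenerate tmul.
Proof.
have [s [[sb s0] sn]] := emul_nondegenerate A.
have [t [[tb t0] tn]] := emul_nondegenerate C.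
exists [seq tens u w | u <- s, w <- t]; split; first split.
- exact: tens_basis.
- move=> _ _ /allpairsP[[a c] /= [as_ ct ->]] /allpairsP[[b d] /= [bs dt ->]] n.
  rewrite tmulE; case: (eqVneq a b) => [e|ab]; last by rewrite s0 // linear0l.
  rewrite (t0 c d) // ?linear0r //; apply: contra_neq n => ->; by rewrite e.
- move=> _ /allpairsP[[a c] /= [as_ ct ->]].
  by rewrite tmulE tens_neq0 ?sn ?tn.
Qed.

Definition tensor : natEvoAlg K :=
  @NatEvoAlg K (tspace A C) tmul _ tline tline_dim tline_direct tline_full
    tline_orth tmul_nondegenerate.

End TensorAlgebra.

Definition isomorphic_relative (K : fieldType) (A B C : natEvoAlg K) : Prop :=
  exists phi : 'Hom(tensor A C, tensor B C),
    is_isomorphism phi /\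
    forall r : lines C, exists psi : 'Hom(A, B),
      forall a : A, phi (tens a (nvec r)) = tens (psi a) (nvec r).

(* Main.v *)
Require Import Defs.
From HB Require Import structures.
From mathcomp Require Import all_boot all_order all_algebra.
From Stdlib Require Import Classical.

(* Write psi_r for the linear bijection A -> B induced on the slice A (x) c_r.
   An edge r -> s of Gamma(C) says that psi_s (a a') = psi_r a psi_r a', so
   r |-> psi_r is a graph homomorphism from Gamma(C) to the relation
   "g (a a') = f a f a'" on line-preserving bijections, and a loop f -> f of
   this relation is an isomorphism A -> B.  The relation is closed under the
   Maltsev operation f g^-1 h.  Since C is indecomposable, Gamma(C) is connected
   and has a cycle of balance exactly 1, and a Maltsev-closed relation R with a
   closed walk of balance 1 has a loop: two vertices with a common out-neighbor
   have the same out-neighbors, so deleting all peaks x -> u <- y of the walk at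
   once gives a shorter closed walk of the same balance in the relation
   R R R^-1, and a loop of R R R^-1 yields one of R. *)

Set Implicit Arguments.
Unset Strict Implicit.
Unset Printing Implicit Defensive.

Import Order.TTheory GRing.Theory Num.Theory.
Local Open Scope ring_scope.

(** * Loops in Maltsev-closed relations *)

Section LoopLemma.
Variables (M : Type) (D : M -> Prop) (m : M -> M -> M -> M).
Hypothesis m_id_r : forall x y, D x -> D y -> m x y y = x.
Hypothesis m_id_l : forall x y, D x -> D y -> m x x y = y.
Implicit Types (R : M -> M -> Prop) (w : seq bool).

Definition maltsev_rel R : Prop :=
  (forall x y, R x y -> D x /\ D y) /\
  (forall x y z x' y' z', R x x' -> R y y' -> R z z' ->
     R (m x y z) (m x' y' z')).

(** Apply [m] coordinatewise to the edges from [x], [x'], [x'] to [y], [y], [y']: the Maltsev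
    identities leave [x] and [y']. *)
Lemma rectangular R x y x' y' :
  maltsev_rel R -> R x y -> R x' y -> R x' y' -> R x y'.
Proof.
move=> [RD Rm] xy x'y x'y'.
have [[Dx Dy] [Dx' Dy']] := (RD _ _ xy, RD _ _ x'y').
by have := Rm _ _ _ _ _ _ xy x'y x'y'; rewrite m_id_r // m_id_l.
Qed.

(* A word records the directions of the steps, [true] meaning forwards. *)
Definition step R (d : bool) x y : Prop := if d then R x y else R y x.

Fixpoint walk R x w y : Prop :=
  if w is d :: w' then exists2 z, step R d x z & walk R z w' y else x = y.

Lemma walk_rcons R x w d y z :
  walk R x w y -> step R d y z -> walk R x (rcons w d) z.
Proof.
elim: w x => [|d' w IHw] x /=; first by move=> -> yz; exists z.
by case=> u xu uy yz; exists u => //; apply: IHw.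
Qed.

(** Two steps forwards and one back have net balance 1, so a word keeps its balance when its letters
    are read as steps of [fold R]. *)
Definition fold R x y : Prop := exists u v, [/\ R x u, R u v & R y v].

Lemma maltsev_fold R : maltsev_rel R -> maltsev_rel (fold R).
Proof.
move=> [RD Rm]; split=> [x y [u [v [xu _ yv]]]|].
  by have [[? _] [? _]] := (RD _ _ xu, RD _ _ yv).
move=> x y z x' y' z' [u1 [v1 [? ? ?]]] [u2 [v2 [? ? ?]]] [u3 [v3 [? ? ?]]].
by exists (m u1 u2 u3), (m v1 v2 v3); split; apply: Rm.
Qed.

Lemma fold_loop R x : maltsev_rel R -> fold R x x -> exists y, R y y.
Proof.
by move=> Rm [u [v [xu uv xv]]]; exists u; apply: (rectangular Rm uv xv).
Qed.

(** A single pass: peaks created by the deletions stay, since they are peaks of [fold R] and no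
    longer of [R]. *)
Fixpoint drop_peaks w : seq bool :=
  match w with
  | true :: (false :: w'') => drop_peaks w''
  | d :: w' => d :: drop_peaks w'
  | [::] => [::]
  end.

Lemma drop_peaks_cons d w :
  d ==> head true w -> drop_peaks (d :: w) = d :: drop_peaks w.
Proof. by case: d w => [] [|[] w]. Qed.

Lemma word_ind (P : seq bool -> Prop) :
  P [::] -> (forall w, P w -> P [:: true, false & w]) ->
  (forall d w, d ==> head true w -> P w -> P (d :: w)) ->
  forall w, P w.
Proof.
move=> P0 P2 P1 w; have [n] := ubnP (size w).
elim: n w => // n IHn [|d w] //= sw; rewrite ltnS in sw.
have [dw|] := boolP (d ==> head true w); first by apply: P1 => //; apply: IHn.
case: d => //; case: w sw => [|[] w] //= sw _.
by apply/P2/IHn/ltnW.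
Qed.

Definition balance w : int := \sum_(d <- w) (if d then 1 else -1).

Lemma balance_cons d w : balance (d :: w) = (if d then 1 else -1) + balance w.
Proof. by rewrite /balance big_cons. Qed.

Lemma balance_nseq n d : balance (nseq n d) = (if d then 1 else -1) *+ n.
Proof. by rewrite /balance big_nseq iter_addr_0. Qed.

Lemma balance_rcons w d : balance (rcons w d) = balance (d :: w).
Proof. by rewrite /balance -cats1 big_cat big_seq1 /= addrC big_cons. Qed.

Lemma balance_drop_peaks w : balance (drop_peaks w) = balance w.
Proof.
elim/word_ind: w => [|w IHw|d w dw IHw] //.
  by rewrite /= !balance_cons IHw addrA addrN add0r.
by rewrite drop_peaks_cons // !balance_cons IHw.
Qed.

Lemma size_drop_peaks w : (size (drop_peaks w) <= size w)%N.
Proof.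
elim/word_ind: w => [|w IHw|d w dw IHw] //; last by rewrite drop_peaks_cons.
by apply: leq_trans IHw _; rewrite /= -addn2 leq_addr.
Qed.

(** Equal sizes mean that no rise is directly followed by a fall, so all falls come first. *)
Lemma drop_peaks_eq_size w :
  size (drop_peaks w) = size w ->
  exists a b, w = nseq a false ++ nseq b true.
Proof.
elim/word_ind: w => [|w _|d w dw IHw]; first by exists 0%N, 0%N.
  by move=> /= e; have := size_drop_peaks w; rewrite e ltnNge leqnSn.
rewrite drop_peaks_cons //= => -[/IHw[[|a] [b e]]]; last first.
  by case: d dw; rewrite e // => _; exists a.+2, b.
by case: d dw => _; rewrite e; [exists 0%N, b.+1 | exists 1%N, b].
Qed.

Definition fiber R x y : Prop := exists2 u, R x u & R y u.

Lemma fiber_step R x y u : maltsev_rel R -> fiber R x y -> R y u -> R x u.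
Proof. by move=> Rm [v xv yv]; apply: rectangular Rm xv yv. Qed.

Lemma fold_fiber_l R x y z :
  maltsev_rel R -> fiber R x y -> fold R y z -> fold R x z.
Proof.
by move=> Rm xy [u [v [yu uv zv]]]; exists u, v; split=> //;
  apply: fiber_step xy yu.
Qed.

Lemma fold_fiber_r R x y z :
  maltsev_rel R -> fiber R z y -> fold R x y -> fold R x z.
Proof.
by move=> Rm zy [u [v [xu uv yv]]]; exists u, v; split=> //;
  apply: fiber_step zy yv.
Qed.

(* Every vertex outside the peaks has an out-neighbor, hence lies in its own
   fiber; [y] is assumed to have one because the walk may end with a rise. *)
Lemma walk_drop_peaks R w x x0 y u : maltsev_rel R ->
  fiber R x0 x -> walk R x w y -> R y u ->
  exists2 y', walk (fold R) x0 (drop_peaks w) y' & fiber R y' y.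
Proof.
move=> Rm + + yu; elim/word_ind: w x x0 => [|w IHw|d w dw IHw] x x0 x0x.
- by move=> xy; exists x0 => //; rewrite -xy.
- move=> /= [p xp [x' x'p]]; apply: IHw.
  by exists p => //; apply: fiber_step x0x xp.
rewrite drop_peaks_cons // => -[z xz wz].
have zz : fiber R z z.
  case: d dw xz => /= [|_ zx]; last by exists x.
  case: w {IHw} wz => [/= -> _ _|[] w] //=; first by exists u.
  by move=> [t zt _] _ _; exists t.
have [y' wy' y'y] := IHw z z zz wz.
exists y' => //; exists z => //.
(* Pad the edge to a step of [fold R]: a rise becomes [x0 -> z -> t <- z], a fall read backwards
   becomes [z -> x -> v <- x0]. *)
case: d {dw} xz => /= [xz|zx]; have [t zt _] := zz.
  by exists z, t; split=> //; apply: fiber_step x0x xz.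
have [v x0v xv] := x0x.
by exists x, v.
Qed.

Theorem loop_of_balance1_walk R w x :
  maltsev_rel R -> walk R x w x -> balance w = 1 -> exists y, R y y.
Proof.
have [n] := ubnP (size w); elim: n R w x => // n IHn R w x sw Rm wx bw.
(* Rotating the walk by one step makes its base a tail, not a peak. *)
have {x sw wx bw} [w' [x [u [sw wx bw xu w'_ends]]]] : exists w' x' u,
    [/\ (size w' <= n)%N, walk R x' w' x', balance w' = 1, R x' u
      & head true w' || ~~ last true w'].
  case: w wx bw sw => [_ bw|[] w /= [z xz wz] bw]; rewrite ?ltnS => sw.
  - by move: bw; rewrite /balance big_nil.
  - by exists (true :: w), x, z; split=> //; exists z.
  exists (rcons w false), z, x; split=> //.
  - by rewrite size_rcons.
  - exact: (walk_rcons (d := false) wz xz).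
  - by rewrite balance_rcons.
  - by rewrite last_rcons orbT.
have xx : fiber R x x by exists u.
have [y wy yx] := walk_drop_peaks Rm xx wx xu.
have [e|ne] := eqVneq (size (drop_peaks w')) (size w').
  (* Without peaks the word is falls, then rises. With no fall, balance 1 leaves a single rise, a
     loop; with a fall, [w'_ends] forbids rises and the balance is negative. *)
  have [[|a] [b ew]] := drop_peaks_eq_size e.
    move: bw wx; rewrite ew balance_nseq natz => -[->] [z xz zx].
    by exists x; rewrite -[X in R _ X]zx.
  move: w'_ends bw; rewrite ew /= last_cat.
  case: b {ew} => [|b] /=; last by suff -> : last true (nseq b true) by []; elim: b.
  by rewrite cats0 => _; rewrite (balance_nseq a.+1 false) mulNrn natz.
(* [y] and [x] have the same out-neighbors, so the first step, which exists because the balance is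
   1, can start at [y]. *)
have wyy : walk (fold R) y (drop_peaks w') y.
  case: (drop_peaks w') (balance_drop_peaks w') wy => [|d v _ /= [z xz vy]].
    by rewrite bw /balance big_nil.
  exists z => //; case: d xz => /= xz.
    exact: fold_fiber_l Rm yx xz.
  exact: fold_fiber_r Rm yx xz.
have sw' : (size (drop_peaks w') < n)%N.
  by apply: leq_trans sw; rewrite ltn_neqAle ne size_drop_peaks.
have bw' : balance (drop_peaks w') = 1 by rewrite balance_drop_peaks.
have [z zz] := IHn _ _ _ sw' (maltsev_fold Rm) wyy bw'.
exact: fold_loop Rm zz.
Qed.
End LoopLemma.

(** * Balances of paths in a connected graph *)

Section GraphBalance.
Variables (T : finType) (e : rel T).
Implicit Types (p q : seq (bool * T)) (k l : int).

Definition joined x y k : Prop :=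
  exists p, [/\ is_path e x p, path_end x p = y & path_balance p = k].

Lemma joined0 x : joined x x 0.
Proof. by exists [::]; rewrite /path_balance big_nil. Qed.

Lemma joined_step x y (d : bool) :
  (if d then e x y else e y x) -> joined x y (if d then 1 else -1).
Proof.
by move=> xy; exists [:: (d, y)]; rewrite /= xy /path_balance big_seq1.
Qed.

Lemma joinedD x y z k l : joined x y k -> joined y z l -> joined x z (k + l).
Proof.
move=> [p [xp <- <-]] [q [yq qz <-]]; exists (p ++ q); split.
- elim: p x xp yq {qz} => [//|[d w] p IHp x] /= /andP[-> wp].
  exact: IHp.
- by rewrite /path_end map_cat last_cat.
- by rewrite /path_balance big_cat.
Qed.

Lemma joinedN x y k : joined x y k -> joined y x (- k).
Proof.
move=> [p [+ <- <-]] {y k}; elim: p x => [|[d w] p IHp] x /=.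
  by move=> _; rewrite /path_balance big_nil oppr0; apply: joined0.
move=> /andP[xw /IHp wp]; rewrite /path_balance big_cons opprD addrC.
apply: joinedD wp _.
have -> : - (if d then 1 else -1) = if ~~ d then 1 else -1 :> int.
  by case: d {xw}; rewrite ?opprK.
by apply: joined_step; move: xw; case: d.
Qed.

Lemma joinedMz x k l : joined x x k -> joined x x (k *~ l).
Proof.
have joinedMn j n : joined x x j -> joined x x (j *+ n).
  move=> xj; elim: n => [|n IHn]; first by rewrite mulr0n; apply: joined0.
  by rewrite mulrS; apply: joinedD xj IHn.
by move=> xk; case: l => n; [|apply: joinedN]; apply: joinedMn xk.
Qed.

(** The balances of closed paths at [x] form a subgroup of the integers; its least positive element
    [d] divides every cycle balance, hence divides 1. *)
Lemma cycle_balance1 x :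
  (forall y, exists k, joined x y k) -> graph_balance e 1 -> joined x x 1.
Proof.
move=> conn [_ bal1].
(* Conjugating by a path from [x] to [v] moves the cycle to [x] without changing its balance. *)
have cycles v p : is_cycle e v p -> joined x x (path_balance p).
  move=> /andP[vp /eqP pv]; have [k xv] := conn v.
  have -> : path_balance p = k + path_balance p - k by rewrite addrC addKr.
  by apply: joinedD _ (joinedN xv); apply: joinedD xv _; exists p.
pose P n := (0 < n)%N /\ joined x x n%:Z.
have exP : exists n, P n.
  (* Otherwise every cycle balance is 0, so 0 is a common divisor and must divide 1. *)
  apply: NNPP => noP; suff : (0 %| 1)%N by [].
  apply: bal1 => v p /cycles xp; rewrite dvd0n absz_eq0.
  apply: contraT => p_neq0; case: noP; exists `|path_balance p|%N.
  split; rewrite ?absz_gt0 // abszE.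
  by case: (ger0P (path_balance p)) => _ //; apply: joinedN.
have [d [d_gt0 xd] dmin] : exists2 d, P d & forall d', P d' -> (d <= d')%N.
  have [n] := exP; have [b] := ubnP n; elim: b n => // b IHb n nb Pn.
  have [[n' [Pn' lt_n'n]]|nomin] := classic (exists n', P n' /\ (n' < n)%N).
    by apply: (IHb n') => //; apply: leq_trans lt_n'n nb.
  exists n => // n' Pn'; rewrite leqNgt; apply/negP => lt_n'n.
  by apply: nomin; exists n'.
have : (d %| 1)%N.
  apply: bal1 => v p /cycles xp.
  (* The remainder modulo [d] is again a balance at [x], so minimality of [d] makes it 0. *)
  rewrite -[d]absz_nat -dvdzE; apply/dvdz_mod0P/eqP; apply: contraT => r_neq0.
  have r_ge0 := modz_ge0 (path_balance p) (lt0r_neq0 (d_gt0 : 0 < d%:Z)).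
  set r := modz _ _ in r_neq0 r_ge0.
  have : (d <= `|r|)%N.
    apply: dmin; split; first by rewrite absz_gt0.
    rewrite gez0_abs // /r /modz -mulNr mulrC -mulrzz.
    by apply: joinedD xp _; apply: joinedMz.
  by rewrite leqNgt -ltz_nat gez0_abs // ltz_pmod.
by rewrite dvdn1 => /eqP d1; move: xd; rewrite d1.
Qed.

Lemma connect_joined x y :
  connect (relU e (fun x y => e y x)) x y -> exists k, joined x y k.
Proof.
move=> /connectP[p + ->]; elim: p x => [|z p IHp] x /=.
  by exists 0; apply: joined0.
move=> /andP[xz /IHp[l zl]]; case/orP: xz => [xz|zx].
  by exists (1 + l); apply: joinedD _ zl; apply: (joined_step (d := true)).
by exists (-1 + l); apply: joinedD _ zl; apply: (joined_step (d := false)).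
Qed.
End GraphBalance.

(** * Coordinates in the line basis and connectedness of the graph *)

Section Coordinates.
Variables (K : fieldType) (X : natEvoAlg K).
Implicit Types (i j : lines X).

Lemma ncoord_nvec i j : ncoord i (nvec j) = (i == j)%:R.
Proof.
have -> : nvec j = (nbasis X)`_(enum_rank j).
  by rewrite -tnth_nth tnth_mktuple enum_rankK.
rewrite /ncoord coord_free ?(basis_free (nbasisP X)) //.
by rewrite (inj_eq enum_rank_inj) eq_sym.
Qed.

Lemma ncoord_sum (x : X) : x = \sum_i ncoord i x *: nvec i.
Proof.
rewrite {1}(coord_basis (nbasisP X) (memvf x)).
rewrite (reindex (@enum_rank (lines X))); last exact/onW_bij/enum_rank_bij.
by apply: eq_bigr => i _; rewrite -tnth_nth tnth_mktuple enum_rankK.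
Qed.

Lemma emul_nvecl i (x : X) :
  emul (nvec i) x = ncoord i x *: emul (nvec i) (nvec i).
Proof.
rewrite {1}[x]ncoord_sum linear_sumr (bigD1 i) //= linearZr_LR big1 ?addr0 //.
by move=> j ji; rewrite linearZr_LR /= emul_nvec0 ?scaler0 // eq_sym.
Qed.

Lemma emul_nvecr i (x : X) :
  emul x (nvec i) = ncoord i x *: emul (nvec i) (nvec i).
Proof.
rewrite {1}[x]ncoord_sum linear_sumlz (bigD1 i) //= linearZl_LR big1 ?addr0 //.
by move=> j ji; rewrite linearZl_LR /= emul_nvec0 ?scaler0.
Qed.

Definition nspan (P : pred (lines X)) : {vspace X} :=
  <<[seq nvec i | i <- enum P]>>%VS.

Lemma nvec_nspan (P : pred (lines X)) i : P i -> nvec i \in nspan P.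
Proof. by move=> Pi; apply/memv_span/map_f; rewrite mem_enum. Qed.

(** Both lists together permute the natural basis; this yields bases of the two spans and the
    directness of their sum. *)
Lemma free_nvec (P : pred (lines X)) :
  free ([seq nvec i | i <- enum P] ++ [seq nvec i | i <- enum (predC P)]).
Proof.
rewrite -map_cat; have := basis_free (nbasisP X); congr is_true.
apply: perm_free.
rewrite /= (map_comp _ enum_val) perm_map // uniq_perm //.
- by rewrite map_inj_uniq ?enum_uniq //; apply: enum_val_inj.
- rewrite cat_uniq !enum_uniq andbT /=; apply/hasPn => i.
  by rewrite !mem_enum.
move=> i; rewrite mem_cat !mem_enum [RHS]orbN; apply/mapP.
by exists (enum_rank i); rewrite ?mem_enum ?enum_rankK.
Qed.

Lemma nspan_evolution P : evolution (@emul K X) (nspan P).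
Proof.
exists [seq nvec i | i <- enum P]; split.
  by rewrite basisEfree (catl_free (free_nvec P)) subvv dim_span.
move=> _ _ /mapP[i _ ->] /mapP[j _ ->] ij; apply: emul_nvec0.
by apply: contra_neq ij => ->.
Qed.

(** The product of [nvec i] with any vector is a multiple of its square, which is supported on the
    out-neighbors of [i]. *)
Lemma nspan_ideal (P : pred (lines X)) :
  (forall i j, P i -> Gamma i j -> P j) -> is_ideal (@emul K X) (nspan P).
Proof.
move=> closedP x y; rewrite {1}/nspan => /(@coord_span _ _ _ (in_tuple _)) ->.
have sq i : P i -> emul (nvec i) (nvec i) \in nspan P.
  move=> Pi; rewrite [emul _ _]ncoord_sum memv_suml // => j _.
  have [-> |ij] := eqVneq (ncoord j (emul (nvec i) (nvec i))) 0.
    by rewrite scale0r mem0v.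
  by rewrite memvZ ?nvec_nspan // (closedP i).
split.
  rewrite linear_sumr memv_suml // => t _; rewrite linearZr_LR memvZ //.
  have /mapP[i + ->] := mem_nth 0 (ltn_ord t).
  by rewrite mem_enum => Pi; rewrite emul_nvecr memvZ ?sq.
rewrite linear_sumlz memv_suml // => t _; rewrite linearZl_LR memvZ //.
have /mapP[i + ->] := mem_nth 0 (ltn_ord t).
by rewrite mem_enum => Pi; rewrite emul_nvecl memvZ ?sq.
Qed.

Lemma indecomposable_connect i j : indecomposable X ->
  connect (relU (@Gamma K X) (fun r s => Gamma s r)) i j.
Proof.
move=> [_ indec]; apply: contraT => nij; case: indec.
set e := relU _ _ in nij.
have e_sym : connect_sym e.
  by apply: sym_connect_sym => r s; rewrite /= orbC.
(* Take the component of [i] in the underlying undirected graph: it and its complement are both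
   closed under edges, so they span complementary ideals. *)
have [P [PG Pi nPj]] : exists P : pred (lines X),
    [/\ forall r s, Gamma r s -> P r = P s, P i & ~~ P j].
  exists (connect e i); split=> //.
  move=> r s rs; apply: same_connect_r => //.
  by apply: connect1; rewrite /= rs.
have nspan_neq0 (Q : pred (lines X)) r : Q r -> nspan Q <> 0%VS.
  by move=> /nvec_nspan + Q0; rewrite Q0 memv0; apply/negP/nvec_neq0.
exists (nspan P), (nspan (predC P)); split.
- by split; apply: nspan_ideal => r s + /PG rs; rewrite /= rs.
- by split; apply: nspan_evolution.
- by split; [apply: (nspan_neq0 _ i) | apply: (nspan_neq0 _ j)].
have /directv_addP -> : directv (nspan P + nspan (predC P)).
  by have := free_nvec P; rewrite cat_free => /and3P[_ _].
split=> //; apply/eqP; rewrite eqEsubv subvf -(line_full X).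
apply/subv_sumP => r _; rewrite lineE -memvE.
have [Pr|nPr] := boolP (P r).
  by apply: subvP (addvSl _ _) _ _; apply: nvec_nspan.
by apply: subvP (addvSr _ _) _ _; apply: nvec_nspan.
Qed.
End Coordinates.

(** This is the identity of [U] tensored with the coordinate functional at [s]; it extracts the
    slice at [s] of a tensor. *)
Lemma contraction_exists (K : fieldType) (U : vectType K) (C : natEvoAlg K)
    (s : lines C) :
  exists g : 'Hom(tspace U C, U), forall u c, g (tens u c) = ncoord s c *: u.
Proof.
pose f (u : U) (c : C) := ncoord s c *: u.
have fB : bilinear_for *:%R *:%R f.
  split=> [c|u] k x y /=; rewrite /f /ncoord.
    by rewrite scalerDr !scalerA mulrC.
  by rewrite linearP scalerDl scalerA.
pose fM := bilinear_isBilinear.Build K U C U *:%R *:%R f fB.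
pose fL : {bilinear U -> C -> U} := HB.pack f fM.
by have [g [gE _]] := tens_universal fL; exists g.
Qed.

(** * Line-preserving bijections and twisted homomorphisms *)

Section LineIso.
Variable K : fieldType.
Implicit Types A B X Y Z : natEvoAlg K.

Definition line_map X Y (f : 'Hom(X, Y)) : Prop :=
  forall i, exists j, (f @: line i)%VS = line j.

Lemma line_map_comp X Y Z (f : 'Hom(Y, Z)) (g : 'Hom(X, Y)) :
  line_map f -> line_map g -> line_map (f \o g)%VF.
Proof.
move=> fl gl i; have [j gi] := gl i; have [k fj] := fl j.
by exists k; rewrite limg_comp gi.
Qed.

Definition line_iso X Y (f : 'Hom(X, Y)) : Prop :=
  [/\ line_map f, line_map f^-1%VF, cancel f f^-1%VF & cancel f^-1%VF f].

Lemma line_isoP X Y (f : 'Hom(X, Y)) (g : 'Hom(Y, X)) :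
  line_map f -> line_map g -> cancel f g -> cancel g f -> line_iso f.
Proof.
move=> fl gl fK gK; have fVK : cancel f f^-1%VF.
  exact/lker0_lfunK/lker0P/(can_inj fK).
have e : g = f^-1%VF by apply/lfunP => y; rewrite -{2}[y]gK fVK.
by rewrite e in gl gK.
Qed.

Definition lmalt X Y (f g h : 'Hom(X, Y)) : 'Hom(X, Y) :=
  (f \o (g^-1 \o h))%VF.

Lemma lmalt_iso X Y (f g h : 'Hom(X, Y)) :
  line_iso f -> line_iso g -> line_iso h -> line_iso (lmalt f g h).
Proof.
move=> [fl fVl fK fVK] [gl gVl gK gVK] [hl hVl hK hVK].
apply: (@line_isoP _ _ _ (h^-1 \o (g \o f^-1))%VF).
- by do !apply: line_map_comp.
- by do !apply: line_map_comp.
- by move=> x; rewrite /lmalt !comp_lfunE /= fK gVK hK.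
- by move=> x; rewrite /lmalt !comp_lfunE /= hVK gK fVK.
Qed.

Definition twisted_hom A B (f g : 'Hom(A, B)) : Prop :=
  [/\ line_iso f, line_iso g & forall x y, g (emul x y) = emul (f x) (f y)].

Lemma twisted_hom_maltsev A B :
  maltsev_rel (@line_iso A B) (@lmalt A B) (@twisted_hom A B).
Proof.
split=> [f g [] //|f g h f' g' h' [fi f'i ff'] [gi g'i gg'] [hi h'i hh']].
split; [exact: lmalt_iso|exact: lmalt_iso|] => x y.
rewrite /lmalt !comp_lfunE /= hh'.
have [_ _ _ gVK] := gi; have [_ _ g'K _] := g'i.
(* With [u = g^-1 (h x)] and [v = g^-1 (h y)], the product of [h x] and [h y] is that of [g u] and
   [g v], hence [g' (emul u v)]; then [f' \o g'^-1] turns it into [emul (f u) (f v)]. *)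
by rewrite -[h x]gVK -[h y]gVK -gg' g'K !gVK ff'.
Qed.

Lemma twisted_hom_loop A B (f : 'Hom(A, B)) :
  twisted_hom f f -> isomorphic A B.
Proof.
move=> [[fl fVl fK fVK] _ fM]; exists f; split.
  split=> // i; have [j fi] := fl i; exists j; split=> //.
  by move=> x y _ _; exact: (can_inj fK).
exists f^-1%VF; split=> //; split.
  by move=> x y; rewrite -{1}[x]fVK -{1}[y]fVK -fM fK.
move=> i; have [j fi] := fVl i; exists j; split=> //.
by move=> x y _ _; exact: (can_inj fVK).
Qed.
End LineIso.

(** * Components of a relative isomorphism *)

Section Components.
Variables (K : fieldType) (C : natEvoAlg K).
Implicit Types A B : natEvoAlg K.

Definition component A B (phi : 'Hom(tensor A C, tensor B C)) r
    (f : 'Hom(A, B)) : Prop :=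
  forall a, phi (tens a (nvec r)) = tens (f a) (nvec r).

Lemma tens_nvec_inj (U : vectType K) (r : lines C) (u v : U) :
  tens u (nvec r) = tens v (nvec r) -> u = v.
Proof.
have [g gE] := contraction_exists U r.
by move=> /(congr1 g); rewrite !gE ncoord_nvec eqxx !scale1r.
Qed.

Lemma component_inj A B (phi : 'Hom(tensor A C, tensor B C)) r f :
  injective phi -> component phi r f -> injective f.
Proof.
move=> phi_inj fr a b fab; apply: (@tens_nvec_inj _ r); apply: phi_inj.
by rewrite !fr fab.
Qed.

Lemma component_line_map A B (phi : 'Hom(tensor A C, tensor B C)) r f :
  is_morphism phi -> injective phi -> component phi r f -> line_map f.
Proof.
move=> [_ phil] phi_inj fr i; have [[j s] [_ phi_line]] := phil (i, r).
have f_inj := component_inj phi_inj fr.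
have fi_neq0 : f (nvec i) != 0 by rewrite -(linear0 f) inj_eq ?nvec_neq0.
exists j; apply/eqP; rewrite eqEdim line_dim lineE limg_line dim_vline fi_neq0.
rewrite andbT -memvE.
have : phi (tens (nvec i) (nvec r)) \in @tline K B C (j, s).
  by rewrite -[tline _]phi_line memv_img // memv_line.
rewrite fr => /vlineP[k /= fi].
have [g gE] := contraction_exists B r; have := congr1 g fi.
rewrite linearZ /= !gE ncoord_nvec eqxx scale1r scalerA => ->.
by rewrite memvZ // memv_pick.
Qed.

(** Apply [phi] to the product of [tens x (nvec r)] and [tens y (nvec r)] and compare slices at [s]:
    both sides carry the same coefficient, nonzero because of the edge. *)
Lemma component_edge A B (phi : 'Hom(tensor A C, tensor B C)) r s f g :
  is_morphism phi -> (forall t, exists h, component phi t h) ->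
  component phi r f -> component phi s g -> Gamma r s ->
  forall x y, g (emul x y) = emul (f x) (f y).
Proof.
move=> [phiM _] phiC fr gs /= rs x y.
have [p pE] := contraction_exists B s.
have := phiM (tens x (nvec r)) (tens y (nvec r)).
rewrite /= !fr !tmulE => /(congr1 p); rewrite pE.
set c := emul (nvec r) (nvec r) in rs *.
rewrite {1}[c]ncoord_sum linear_sumr linear_sum linear_sum /= (bigD1 s) //=.
rewrite linearZr_LR !linearZ /= gs pE ncoord_nvec eqxx scale1r big1 => [|t ts].
  by rewrite addr0 => /(scalerI rs).
have [h ht] := phiC t.
rewrite linearZr_LR !linearZ /= ht pE ncoord_nvec eq_sym (negbTE ts).
by rewrite scale0r scaler0.
Qed.

Lemma component_line_iso A B (phi : 'Hom(tensor A C, tensor B C)) r f :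
  is_isomorphism phi -> component phi r f -> line_iso f.
Proof.
move=> [phim [phiV [phiVm phiK phiVK]]] fr.
have f_inj := component_inj (can_inj phiK) fr.
have ker0 : lker f == 0%VS by apply/lker0P.
have fK := lker0_lfunK ker0.
(* Injectivity of [phiV] bounds dim B * dim C by dim A * dim C, and dim C > 0 cancels. *)
have fT : limg f = fullv.
  apply/eqP; rewrite eqEdim subvf /= limg_dim_eq ?(eqP ker0) ?capv0 //.
  have C_gt0 : (0 < \dim {:C})%N.
    by rewrite -card_lines; apply/card_gt0P; exists r.
  have := dimvS (subvf (limg phiV)).
  rewrite limg_dim_eq; last first.
    by have /lker0P/eqP -> := can_inj phiVK; rewrite capv0.
  by rewrite !tspace_dim leq_pmul2r.
have fVK : cancel f^-1%VF f.
  by move=> y; rewrite limg_lfunVK // fT memvf.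
have fVr : component phiV r f^-1%VF.
  by move=> b; rewrite -{1}[b]fVK -fr phiK.
apply: line_isoP fK fVK; first exact: component_line_map (can_inj phiK) fr.
exact: component_line_map (can_inj phiVK) fVr.
Qed.

Lemma component_walk A B (phi : 'Hom(tensor A C, tensor B C)) r p f :
  is_isomorphism phi -> (forall t, exists h, component phi t h) ->
  component phi r f -> is_path (@Gamma K C) r p ->
  exists2 g, walk (@twisted_hom K A B) f (map fst p) g
    & component phi (path_end r p) g.
Proof.
move=> phii phiC; have phim := phii.1.
elim: p r f => [|[d s] p IHp] r f fr /=; first by exists f.
move=> /andP[rs sp]; have [h hs] := phiC s; have [g hg gp] := IHp _ _ hs sp.
have fi := component_line_iso phii fr; have hi := component_line_iso phii hs.
exists g => //; exists h => //.
by case: d rs => /= rs; split=> //;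
  [apply: component_edge fr hs rs|apply: component_edge hs fr rs].
Qed.
End Components.

Theorem theorem11p1 (K : fieldType) (A B C : natEvoAlg K)
    (C_indec : indecomposable C) (C_balance : has_balance C 1)
    (AC_BC : isomorphic_relative A B C) :
  isomorphic A B.
Proof.
have [phi [phii phiC]] := AC_BC.
have [r _] : exists r : lines C, true.
  case: C_indec => + _; case: (pickP (@predT (lines C))) => [r _ _|noline].
    by exists r.
  case; apply/eqP; rewrite -dimv_eq0 -card_lines.
  by apply/eqP/eq_card0 => r; have := noline r.
have [p [rp pr bp]] : joined (@Gamma K C) r r 1.
  apply: cycle_balance1 C_balance => s.
  exact/connect_joined/indecomposable_connect.
have [f fr] := phiC r.
have [g fg] := component_walk phii phiC fr rp.
rewrite pr => gr.
(* Components at [r] are unique, so the lifted walk closes up although its steps use arbitrary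
   choices. *)
have gf : g = f.
  by apply/lfunP => a; apply: (@tens_nvec_inj _ C _ r); rewrite -gr fr.
rewrite gf in fg.
have balance_p : balance (map fst p) = 1.
  by rewrite -bp /balance big_map.
have [||h /twisted_hom_loop //] :=
  loop_of_balance1_walk _ _ (@twisted_hom_maltsev K A B) fg balance_p.
- by move=> u v _ [_ _ vK _]; apply/lfunP => x; rewrite !comp_lfunE vK.
- by move=> u v [_ _ _ uVK] _; apply/lfunP => x; rewrite !comp_lfunE uVK.
Qed.
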